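(* Let $T$ and $V$ be oriented non-equilateral triangles. The following statements are equivalent. (a) There exist $\xi,\zeta\in\mathbb R\cup\{\infty\}$ such that $\mathcal C_\zeta(V)$ and $\mathcal C_\xi(T)$ are similar. (b) There exists $\rho\in\mathbb M_T$ such that $V$ and $\mathcal C_\rho(T)$ are similar. (c) There exists $\tau\in\mathbb M_V$ such that $T$ and $\mathcal C_\tau(V)$ are similar. (d) $\mathcal C_{\mu_T}(T)$ is similar to $\mathcal C_{\mu_V}(V)$. (e) $\mathcal C_{\nu_T}(T)$ is similar to $\mathcal C_{\nu_V}(V)$. (f) $\gamma_T=\gamma_V$. (g) $\omega_T=\omega_V$.
   Context: An oriented triangle $T=ABC$ has vertices labelled counterclockwise and is written as the ordered triple $T=(a,b,c)$ of side lengths $a=BC$, $b=CA$, $c=AB$ (positive reals with $|a-b|<c<a+b$). Oriented triangles $(a,b,c)$, $(x,y,z)$ are directly similar if $\frac ax=\frac by=\frac cz$ or $\frac ay=\frac bz=\frac cx$ or $\frac az=\frac bx=\frac cy$; reversely similar if $\frac az=\frac by=\frac cx$ or $\frac ay=\frac bx=\frac cz$ or $\frac ax=\frac bz=\frac cy$; similar if they are directly or reversely similar. A non-equilateral isosceles triangle is wide if its legs are shorter than its base, narrow if its legs are longer than its base. Ceva's operators: for $\rho\in\mathbb R$, $\mathcal C_\rho(a,b,c)=(x_\rho,y_\rho,z_\rho)$ with $x_\rho=\sqrt{\rho a^2+(1-\rho)b^2+\rho(\rho-1)c^2}$, $y_\rho=\sqrt{(1-\rho)a^2+\rho(\rho-1)b^2+\rho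 c^2}$, $z_\rho=\sqrt{\rho(\rho-1)a^2+\rho b^2+(1-\rho)c^2}$ (again side lengths of an oriented triangle); $\mathcal C_\infty(a,b,c)=(c,b,a)$. For non-equilateral $T$, $\mu_T$ and $\nu_T$ denote the unique numbers in $\mathbb I=[0,1)$ such that $\mathcal C_{\mu_T}(T)$ is wide and $\mathcal C_{\nu_T}(T)$ is narrow, and $\mathbb M_T=[\min\{\mu_T,\nu_T\},\max\{\mu_T,\nu_T\}]$. The cone angle $\gamma_T$ of $T=(a,b,c)$ is the angle between the vectors $(a^2,b^2,c^2)$ and $(1,1,1)$ in $\mathbb R^3$. The Brocard angle $\omega_T$ of $T=ABC$ is the common value of the angles $PAB=PBC=PCA$, where $P$ is the unique point for which these three angles are equal. *)

(* Defs.v *)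
From mathcomp Require Import all_boot all_order all_algebra.
From mathcomp Require Import all_classical all_reals all_analysis.

Set Implicit Arguments.
Unset Strict Implicit.
Unset Printing Implicit Defensive.

Import Order.TTheory GRing.Theory Num.Theory.
Local Open Scope ring_scope.

(* A triple of reals is the triple (BC, CA, AB) of side lengths of a triangle
   ABC whose vertices are labelled counterclockwise. *)
Definition oriented_triangle (R : realType) (T : R * R * R) : Prop :=
  let: (a, b, c) := T in
  [/\ 0 < a, 0 < b, 0 < c, `|a - b| < c & c < a + b].

Definition equilateral (R : realType) (T : R * R * R) : Prop :=
  let: (a, b, c) := T in a = b /\ b = c.

(* An isosceles triangle which is not equilateral, by position of its base. *)
Definition wide (R : realType) (T : R * R * R) : Prop :=
  let: (a, b, c) := T in
  [\/ b = c /\ b < a, c = a /\ c < b | a = b /\ a < c].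

Definition narrow (R : realType) (T : R * R * R) : Prop :=
  let: (a, b, c) := T in
  [\/ b = c /\ a < b, c = a /\ b < c | a = b /\ c < a].

Definition directly_similar (R : realType) (T V : R * R * R) : Prop :=
  let: (a, b, c) := T in let: (x, y, z) := V in
  [\/ a / x = b / y /\ b / y = c / z,
      a / y = b / z /\ b / z = c / x
    | a / z = b / x /\ b / x = c / y].

Definition reversely_similar (R : realType) (T V : R * R * R) : Prop :=
  let: (a, b, c) := T in let: (x, y, z) := V in
  [\/ a / z = b / y /\ b / y = c / x,
      a / y = b / x /\ b / x = c / z
    | a / x = b / z /\ b / z = c / y].

Definition similar_triangles (R : realType) (T V : R * R * R) : Prop :=
  directly_similar T V \/ reversely_similar T V.

Definition ceva (R : realType) (rho : R) (T : R * R * R) : R * R * R :=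
  let: (a, b, c) := T in
  (Num.sqrt (rho * a ^+ 2 + (1 - rho) * b ^+ 2 + rho * (rho - 1) * c ^+ 2),
   Num.sqrt ((1 - rho) * a ^+ 2 + rho * (rho - 1) * b ^+ 2 + rho * c ^+ 2),
   Num.sqrt (rho * (rho - 1) * a ^+ 2 + rho * b ^+ 2 + (1 - rho) * c ^+ 2)).

(* Ceva's operator indexed by the extended line R U {oo}; [None] is oo. *)
Definition ceva_ext (R : realType) (xi : option R) (T : R * R * R) :
    R * R * R :=
  if xi is Some rho then ceva rho T else let: (a, b, c) := T in (c, b, a).

(* When T is a non-equilateral triangle, [xget] below picks the only element
   of its argument. *)
Definition ceva_mu (R : realType) (T : R * R * R) : R :=
  xget 0 [set rho : R | (rho \in `[0, 1[) /\ wide (ceva rho T)]%classic.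

Definition ceva_nu (R : realType) (T : R * R * R) : R :=
  xget 0 [set rho : R | (rho \in `[0, 1[) /\ narrow (ceva rho T)]%classic.

Definition ceva_MM (R : realType) (T : R * R * R) : interval R :=
  `[Num.min (ceva_mu T) (ceva_nu T), Num.max (ceva_mu T) (ceva_nu T)].

(* The library norm on row vectors is the sup norm, whence [enorm]. *)
Definition dot (R : realType) (n : nat) (u v : 'rV[R]_n) : R :=
  \sum_(i < n) u 0 i * v 0 i.

Definition enorm (R : realType) (n : nat) (u : 'rV[R]_n) : R :=
  Num.sqrt (dot u u).

Definition vec_angle (R : realType) (n : nat) (u v : 'rV[R]_n) : R :=
  acos (dot u v / (enorm u * enorm v)).

Definition cone_angle (R : realType) (T : R * R * R) : R :=
  let: (a, b, c) := T in
  vec_angle (\row_(i < 3) [:: a ^+ 2; b ^+ 2; c ^+ 2]`_i) (const_mx 1).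

(* The angle P Q S, with vertex Q. *)
Definition pt_angle (R : realType) (P Q S : 'rV[R]_2) : R :=
  vec_angle (P - Q) (S - Q).

Definition ccw (R : realType) (A B C : 'rV[R]_2) : Prop :=
  let u := B - A in let v := C - A in
  0 < u 0 0 * v 0 1 - u 0 1 * v 0 0.

Definition vertices (R : realType) (T : R * R * R) (A B C : 'rV[R]_2) : Prop :=
  let: (a, b, c) := T in
  [/\ ccw A B C, enorm (C - B) = a, enorm (A - C) = b & enorm (B - A) = c].

(* For a triangle ABC labelled counterclockwise, the first line says that P
   lies in its interior.  Since [pt_angle] is unsigned, an obtuse triangle may
   have exterior points satisfying the two equations. *)
Definition brocard_point (R : realType) (A B C P : 'rV[R]_2) : Prop :=
  [/\ ccw A B P, ccw B C P & ccw C A P] /\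
  (pt_angle P A B = pt_angle P B C /\ pt_angle P B C = pt_angle P C A).

(* The angle does not depend on the placement A, B, C of the triangle T. *)
Definition brocard_angle (R : realType) (T : R * R * R) : R :=
  xget 0 [set w : R | exists A B C P : 'rV[R]_2,
         [/\ vertices T A B C, brocard_point A B C P & w = pt_angle P A B]
       ]%classic.

(* Main.v *)
Require Import Defs.
From mathcomp Require Import all_boot all_order all_algebra.
From mathcomp Require Import all_classical all_reals all_analysis.
From mathcomp Require Import ring lra.

(** Let [w] be a primitive cube root of unity and attach to a triangle with
    sides [a], [b], [c] the complex number
      [q = (a^2 + w b^2 + w^2 c^2) / (a^2 + b^2 + c^2)].
    It determines the triangle up to size, and permuting the sides makes the
    dihedral group generated by [q -> w q] and the complex conjugation act on
    [q]. So two triangles are similar if and only if their numbers [q] are in the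
    same orbit, that is, have the same [|q|^2], called [rel_spread] below, and
    the same real part of [q^3], half of what is called [rel_skew]
    ([similar_invariants], [similar_of_invariants]).

    On the squares of the sides Ceva's operator is linear, and on [q] it acts
    as the conjugation followed by the multiplication by a number of modulus 1.
    It therefore preserves [rel_spread], and so each of the statements about
    similarity implies that [T] and [V] have the same [rel_spread].

    Conversely, given [|q|], the values of [rel_skew] fill the interval from
    [- 2 |q|^3], reached by the narrow triangles, to [2 |q|^3], reached by the
    wide ones ([rel_skew_bound], [rel_skew_wide], [rel_skew_narrow]). Two wide
    triangles, or two narrow ones, with the same [rel_spread] are thus similar.
    Between [ceva_mu T] and [ceva_nu T], the continuous function
    [rel_skew (ceva rho T)] takes all the values of this interval, in particular
    that of any [V] with the same [rel_spread] ([exists_ceva_similar]).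

    Finally, both angles are injective functions of [rel_spread]: the cosine of
    the cone angle is [1 / sqrt (1 + 2 rel_spread)], and the cotangent of the
    Brocard angle is the quotient of [a^2 + b^2 + c^2] by four times the area,
    which Heron's formula turns into [sqrt (3 / (1 - 4 rel_spread))]. Hence all
    the statements are equivalent to the equality of the [rel_spread]s. *)

Set Implicit Arguments.
Unset Strict Implicit.
Unset Printing Implicit Defensive.

Import Order.TTheory GRing.Theory Num.Theory.
Import numFieldNormedType.Exports.
Local Open Scope ring_scope.

(** * Symmetric invariants of a triple *)

(** Ceva's operators and both angles are expressed by the squares of the sides,
    which is why all invariants below are computed on the triple of squares. *)
Definition squares (R : realType) (T : R * R * R) : R * R * R :=
  let: (a, b, c) := T in (a ^+ 2, b ^+ 2, c ^+ 2).

Definition coord_sum (R : realType) (p : R * R * R) : R :=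
  let: (x, y, z) := p in x + y + z.

(** The squared modulus of [x + w y + w^2 z], where [w] is a primitive cube
    root of unity; in other words, up to a constant, the squared distance from
    [(x, y, z)] to the axis spanned by [(1, 1, 1)]. *)
Definition spread (R : realType) (p : R * R * R) : R :=
  let: (x, y, z) := p in
  x ^+ 2 + y ^+ 2 + z ^+ 2 - x * y - y * z - z * x.

(** Twice the real part of [(x + w y + w^2 z)^3], [w] being a primitive cube
    root of unity. Cubing removes the rotations by [w] and the real part removes
    complex conjugation, so this is the remaining symmetric invariant. *)
Definition skewness (R : realType) (p : R * R * R) : R :=
  let: (x, y, z) := p in
  (2 * x - y - z) * (2 * y - z - x) * (2 * z - x - y).

(** Ceva's operator in terms of the squares of the sides, where it is linear. *)
Definition ceva_lin (R : realType) (rho : R) (p : R * R * R) : R * R * R :=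
  let: (x, y, z) := p in
  (rho * x + (1 - rho) * y + rho * (rho - 1) * z,
   (1 - rho) * x + rho * (rho - 1) * y + rho * z,
   rho * (rho - 1) * x + rho * y + (1 - rho) * z).

Definition positive_sides (R : realType) (T : R * R * R) : Prop :=
  let: (a, b, c) := T in [/\ 0 < a, 0 < b & 0 < c].

(** Dividing by the matching power of [coord_sum] makes the invariant
    independent of the size of the triangle. *)
Definition rel_spread (R : realType) (T : R * R * R) : R :=
  spread (squares T) / coord_sum (squares T) ^+ 2.

Definition rel_skew (R : realType) (T : R * R * R) : R :=
  skewness (squares T) / coord_sum (squares T) ^+ 3.

Lemma coord_sum_squares_gt0 (R : realType) (T : R * R * R) :
  positive_sides T -> 0 < coord_sum (squares T).
Proof. by case: T => [[a b] c] [a0 b0 c0] /=; rewrite !addr_gt0 ?exprn_gt0. Qed.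

Lemma spread_ge0 (R : realType) (p : R * R * R) : 0 <= spread p.
Proof.
case: p => [[x y] z] /=.
have -> : x ^+ 2 + y ^+ 2 + z ^+ 2 - x * y - y * z - z * x
        = ((x - y) ^+ 2 + (y - z) ^+ 2 + (z - x) ^+ 2) / 2 by field.
by rewrite divr_ge0 ?ler0n// !addr_ge0 ?sqr_ge0.
Qed.

Lemma spread_eq0 (R : realType) (p : R * R * R) :
  spread p = 0 -> equilateral p.
Proof.
case: p => [[x y] z] /= h.
have h2 : (x - y) ^+ 2 + (y - z) ^+ 2 + (z - x) ^+ 2 = 0.
  by rewrite -(mulr0 2) -h; ring.
have [[p1 p2] p3] := (sqr_ge0 (x - y), sqr_ge0 (y - z), sqr_ge0 (z - x)).
have e1 : (x - y) ^+ 2 = 0 by lra.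
have e2 : (y - z) ^+ 2 = 0 by lra.
by split; apply/eqP; rewrite -subr_eq0 -sqrf_eq0 ?e1 ?e2.
Qed.

Lemma coord_sum_ceva_lin (R : realType) (rho : R) (p : R * R * R) :
  coord_sum (ceva_lin rho p) = (rho ^+ 2 - rho + 1) * coord_sum p.
Proof. by case: p => [[x y] z] /=; ring. Qed.

(** Together with [coord_sum_ceva_lin] this says that Ceva's operator is, up to
    the factor [rho^2 - rho + 1], an isometry fixing the axis [(1, 1, 1)]: on the
    number [x + w y + w^2 z] it acts as a conjugation followed by the
    multiplication by [w^2 (rho + w)^2], of modulus [rho^2 - rho + 1]. *)
Lemma spread_ceva_lin (R : realType) (rho : R) (p : R * R * R) :
  spread (ceva_lin rho p) = (rho ^+ 2 - rho + 1) ^+ 2 * spread p.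
Proof. by case: p => [[x y] z] /=; ring. Qed.

Lemma ceva_factor_gt0 (R : realType) (rho : R) : 0 < rho ^+ 2 - rho + 1.
Proof. by have := sqr_ge0 (rho - 1 / 2); nra. Qed.

(** The difference of the two sides is, up to the factor 27, the discriminant
    of the monic cubic whose roots are [x], [y] and [z]; the bound is thus
    attained exactly by the isosceles triples. *)
Lemma skewness_sqr_le (R : realType) (p : R * R * R) :
  skewness p ^+ 2 <= 4 * spread p ^+ 3.
Proof.
case: p => [[x y] z]; rewrite -subr_ge0 /=.
set d := (X in 0 <= X).
have -> : d = 27 * ((x - y) * (y - z) * (z - x)) ^+ 2 by rewrite /d; ring.
by rewrite mulr_ge0 ?ler0n ?sqr_ge0.
Qed.

Lemma rel_spread_ge0 (R : realType) (T : R * R * R) : 0 <= rel_spread T.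
Proof. by rewrite divr_ge0 ?spread_ge0 ?sqr_ge0. Qed.

Lemma rel_skew_bound (R : realType) (T : R * R * R) :
  positive_sides T -> `|rel_skew T| <= 2 * Num.sqrt (rel_spread T) ^+ 3.
Proof.
move=> /coord_sum_squares_gt0 t0.
have s0 := sqrtr_ge0 (rel_spread T).
rewrite -ler_sqr ?nnegrE ?mulr_ge0 ?exprn_ge0// real_normK ?num_real//.
have -> : (2 * Num.sqrt (rel_spread T) ^+ 3) ^+ 2
        = 4 * (Num.sqrt (rel_spread T) ^+ 2) ^+ 3 by ring.
rewrite sqr_sqrtr ?rel_spread_ge0// /rel_skew /rel_spread !expr_div_n mulrA.
rewrite -!exprM; apply: ler_wpM2r; last exact: skewness_sqr_le.
by rewrite invr_ge0 exprn_ge0// ltW.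
Qed.

(** * Similarity in terms of the invariants *)

Lemma ltr_sqr_gt0 (R : realType) (u v : R) :
  0 < u -> 0 < v -> (u ^+ 2 < v ^+ 2) = (u < v).
Proof. by move=> u0 v0; rewrite ltr_sqr// nnegrE ltW. Qed.

Lemma eqr_sqr_gt0 (R : realType) (u v : R) :
  0 < u -> 0 < v -> (u ^+ 2 = v ^+ 2) = (u = v).
Proof.
move=> u0 v0; apply/propext; split=> [/eqP|->//].
by rewrite eqrXn2 ?ltW// => /eqP.
Qed.

Lemma wide_squares (R : realType) (T : R * R * R) :
  positive_sides T -> wide (squares T) = wide T.
Proof.
by case: T => [[a b] c] [a0 b0 c0] /=; rewrite !ltr_sqr_gt0// !eqr_sqr_gt0.
Qed.

Lemma narrow_squares (R : realType) (T : R * R * R) :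
  positive_sides T -> narrow (squares T) = narrow T.
Proof.
by case: T => [[a b] c] [a0 b0 c0] /=; rewrite !ltr_sqr_gt0// !eqr_sqr_gt0.
Qed.

Lemma rel_spread_scale (R : realType) (k : R) (T V : R * R * R) :
    k != 0 -> coord_sum (squares T) = k * coord_sum (squares V) ->
    spread (squares T) = k ^+ 2 * spread (squares V) ->
  rel_spread T = rel_spread V.
Proof.
move=> k0 tE sE; rewrite /rel_spread tE sE exprMn -mulf_div divff ?mul1r//.
by rewrite expf_neq0.
Qed.

Lemma rel_skew_scale (R : realType) (k : R) (T V : R * R * R) :
    k != 0 -> coord_sum (squares T) = k * coord_sum (squares V) ->
    skewness (squares T) = k ^+ 3 * skewness (squares V) ->
  rel_skew T = rel_skew V.
Proof.
move=> k0 tE sE; rewrite /rel_skew tE sE exprMn -mulf_div divff ?mul1r//.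
by rewrite expf_neq0.
Qed.

Lemma eq_pair_of_invariants (R : realType) (x y z v w : R) :
    coord_sum (x, y, z) = coord_sum (x, v, w) ->
    spread (x, y, z) = spread (x, v, w) ->
  (y = v /\ z = w) \/ (y = w /\ z = v).
Proof.
move=> tE sE; have wE : w = y + z - v by move: tE => /= ?; lra.
have /eqP : 3 * ((y - v) * (y - w)) = 0.
  by rewrite -(subrr (spread (x, v, w))) -{1}sE wE /=; ring.
rewrite !mulf_eq0 pnatr_eq0 /= !subr_eq0 => /orP[]/eqP e; [left|right];
  by split=> //; lra.
Qed.

(** The three invariants determine the elementary symmetric functions, hence
    the cubic with roots [x], [y], [z], hence the triple up to one of the six
    permutations. The permutations are listed in the order in which the cases of
    direct, then of reverse similarity enumerate them. *)
Lemma eq_triple_of_invariants (R : realType) (x y z u v w : R) :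
    coord_sum (x, y, z) = coord_sum (u, v, w) ->
    spread (x, y, z) = spread (u, v, w) ->
    skewness (x, y, z) = skewness (u, v, w) ->
  [\/ [/\ x = u, y = v & z = w], [/\ x = v, y = w & z = u]
    | [/\ x = w, y = u & z = v]] \/
  [\/ [/\ x = w, y = v & z = u], [/\ x = v, y = u & z = w]
    | [/\ x = u, y = w & z = v]].
Proof.
move=> tE sE kE; have wE : w = x + y + z - u - v by move: tE => /= ?; lra.
(* Centering by [X = 2 x - y - z] and so on, [X] is a root of the cubic
   [t^3 - 3 spread t - skewness], with the invariants of either triple. *)
have /eqP : 27 * ((x - u) * (x - v) * (x - w)) = 0.
  transitivity (3 * (2 * x - y - z) * (spread (x, y, z) - spread (u, v, w))
     + (skewness (x, y, z) - skewness (u, v, w))).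
    by rewrite wE /=; ring.
  by rewrite sE kE !subrr mulr0 addr0.
rewrite !mulf_eq0 pnatr_eq0 /= !subr_eq0 => /orP[/orP[]|] /eqP xE.
- case: (@eq_pair_of_invariants _ x y z v w) => [||[-> ->]|[-> ->]].
  + by rewrite tE xE.
  + by rewrite sE xE.
  + by left; constructor 1.
  + by right; constructor 3.
- case: (@eq_pair_of_invariants _ x y z w u) => [||[-> ->]|[-> ->]].
  + by rewrite tE xE /=; ring.
  + by rewrite sE xE /=; ring.
  + by left; constructor 2.
  + by right; constructor 2.
- case: (@eq_pair_of_invariants _ x y z u v) => [||[-> ->]|[-> ->]].
  + by rewrite tE xE /=; ring.
  + by rewrite sE xE /=; ring.
  + by left; constructor 3.
  + by right; constructor 1.
Qed.

(** The six cases of similarity are the six permutations of the sides, and the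
    invariants are symmetric and homogeneous of degree 0. *)
Lemma similar_invariants (R : realType) (T V : R * R * R) :
    positive_sides T -> positive_sides V ->
  similar_triangles T V ->
  rel_spread T = rel_spread V /\ rel_skew T = rel_skew V.
Proof.
case: T V => [[a b] c] [[x y] z] [a0 b0 c0] [x0 y0 z0] sim.
have [r r0 h] : exists2 r : R, r != 0 &
  [\/ [/\ a = r * x, b = r * y & c = r * z],
       [/\ a = r * y, b = r * z & c = r * x]
     | [/\ a = r * z, b = r * x & c = r * y]] \/
  [\/ [/\ a = r * z, b = r * y & c = r * x],
       [/\ a = r * y, b = r * x & c = r * z]
     | [/\ a = r * x, b = r * z & c = r * y]].
  have scale (u : R) : 0 < u -> a / u != 0.
    by move=> u0; rewrite gt_eqF ?divr_gt0.
  have unfold (w u q : R) : 0 < u -> q = w / u -> w = q * u.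
    by move=> u0 ->; rewrite divfK// gt_eqF.
  case: sim => [] [] [e1 e2];
    [exists (a / x)|exists (a / y)|exists (a / z)
    |exists (a / z)|exists (a / y)|exists (a / x)] => //; try exact: scale;
    [left; constructor 1|left; constructor 2|left; constructor 3
    |right; constructor 1|right; constructor 2|right; constructor 3];
    by split; apply: unfold => //; rewrite e1.
have r20 : r ^+ 2 != 0 by rewrite expf_neq0.
by case: h => [] [] [-> -> ->]; split;
  [apply: (rel_spread_scale r20)|apply: (rel_skew_scale r20)
  |apply: (rel_spread_scale r20)|apply: (rel_skew_scale r20)
  |apply: (rel_spread_scale r20)|apply: (rel_skew_scale r20)
  |apply: (rel_spread_scale r20)|apply: (rel_skew_scale r20)
  |apply: (rel_spread_scale r20)|apply: (rel_skew_scale r20)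
  |apply: (rel_spread_scale r20)|apply: (rel_skew_scale r20)] => /=; ring.
Qed.

(** After scaling the squares of the sides of [V] to the same sum as those of
    [T], the two triples have the same invariants, hence agree up to order. *)
Lemma similar_of_invariants (R : realType) (T V : R * R * R) :
    positive_sides T -> positive_sides V ->
    rel_spread T = rel_spread V -> rel_skew T = rel_skew V ->
  similar_triangles T V.
Proof.
move=> pT pV.
have [tT tV] := (coord_sum_squares_gt0 pT, coord_sum_squares_gt0 pV).
pose t := coord_sum (squares T) / coord_sum (squares V).
have t0 : 0 < t by rewrite divr_gt0.
have tE : coord_sum (squares T) = t * coord_sum (squares V).
  by rewrite /t divfK// gt_eqF.
rewrite /rel_spread /rel_skew => sE kE.
have {}sE : spread (squares T) = t ^+ 2 * spread (squares V).
  rewrite -[LHS](@divfK _ (coord_sum (squares T) ^+ 2)) ?expf_neq0 ?gt_eqF// sE.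
  by rewrite /t expr_div_n mulrAC [X in X / _]mulrC [RHS]mulrAC.
have {}kE : skewness (squares T) = t ^+ 3 * skewness (squares V).
  rewrite -[LHS](@divfK _ (coord_sum (squares T) ^+ 3)) ?expf_neq0 ?gt_eqF// kE.
  by rewrite /t expr_div_n mulrAC [X in X / _]mulrC [RHS]mulrAC.
have root (u v : R) :
    0 < u -> 0 < v -> u ^+ 2 = t * v ^+ 2 -> u / v = Num.sqrt t.
  move=> u0 v0 e; have -> : t = (u / v) ^+ 2.
    by rewrite expr_div_n e mulfK// expf_neq0// gt_eqF.
  by rewrite sqrtr_sqr ger0_norm// ltW// divr_gt0.
clearbody t; case: T V pT pV tE sE kE {tT tV}
  => [[a b] c] [[x y] z] [a0 b0 c0] [x0 y0 z0] tE sE kE.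
have := @eq_triple_of_invariants _ (a ^+ 2) (b ^+ 2) (c ^+ 2)
  (t * x ^+ 2) (t * y ^+ 2) (t * z ^+ 2).
case=> [|||h|h].
- by rewrite tE /=; ring.
- by rewrite sE /=; ring.
- by rewrite kE /=; ring.
- left; case: h => [] [h1 h2 h3];
    [constructor 1|constructor 2|constructor 3];
    by rewrite (root _ _ _ _ h1)// (root _ _ _ _ h2)// (root _ _ _ _ h3).
- right; case: h => [] [h1 h2 h3];
    [constructor 1|constructor 2|constructor 3];
    by rewrite (root _ _ _ _ h1)// (root _ _ _ _ h2)// (root _ _ _ _ h3).
Qed.

(** * Ceva's operators *)

Lemma oriented_triangle_positive (R : realType) (T : R * R * R) :
  oriented_triangle T -> positive_sides T.
Proof. by case: T => [[a b] c] []. Qed.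

(** As a quadratic form in [rho * c] and [b], the radicand is squeezed between
    [(rho c - b)^2] and [(rho c + b)^2] because [|b - c| < a < b + c]. *)
Lemma ceva_radicand_gt0 (R : realType) (rho a b c : R) :
    0 < b -> a < b + c -> b < c + a -> c < a + b ->
  0 < rho * a ^+ 2 + (1 - rho) * b ^+ 2 + rho * (rho - 1) * c ^+ 2.
Proof.
move=> b0 abc bca cab; case: (ltrgtP rho 0) => [r0|r0|->].
- have -> : rho * a ^+ 2 + (1 - rho) * b ^+ 2 + rho * (rho - 1) * c ^+ 2
      = (rho * c + b) ^+ 2 + - rho * ((b + c - a) * (a + b + c)) by ring.
  apply: ltr_wpDl; first exact: sqr_ge0.
  by rewrite mulr_gt0 ?oppr_gt0// mulr_gt0//; lra.
- have -> : rho * a ^+ 2 + (1 - rho) * b ^+ 2 + rho * (rho - 1) * c ^+ 2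
      = (rho * c - b) ^+ 2 + rho * ((a + b - c) * (c + a - b)) by ring.
  apply: ltr_wpDl; first exact: sqr_ge0.
  by rewrite mulr_gt0// mulr_gt0//; lra.
- by rewrite !mul0r add0r addr0 subr0 mul1r exprn_gt0.
Qed.

Lemma ceva_radicands_gt0 (R : realType) (rho : R) (T : R * R * R) :
  oriented_triangle T -> positive_sides (ceva_lin rho (squares T)).
Proof.
case: T => [[a b] c] [a0 b0 c0]; rewrite ltr_norml => /andP[h1 h2] h3.
have ab : a < b + c by lra.
have bc : b < c + a by lra.
split.
- exact: ceva_radicand_gt0.
- suff : 0 < rho * c ^+ 2 + (1 - rho) * a ^+ 2 + rho * (rho - 1) * b ^+ 2.
    by move=> h; rewrite addrC addrA.
  exact: ceva_radicand_gt0.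
- suff : 0 < rho * b ^+ 2 + (1 - rho) * c ^+ 2 + rho * (rho - 1) * a ^+ 2.
    by move=> h; rewrite -addrA addrC.
  exact: ceva_radicand_gt0.
Qed.

Lemma positive_ceva (R : realType) (rho : R) (T : R * R * R) :
  oriented_triangle T -> positive_sides (ceva rho T).
Proof.
move=> /(ceva_radicands_gt0 rho); case: T => [[a b] c] /= [x0 y0 z0].
by rewrite !sqrtr_gt0.
Qed.

Lemma squares_ceva (R : realType) (rho : R) (T : R * R * R) :
  oriented_triangle T -> squares (ceva rho T) = ceva_lin rho (squares T).
Proof.
move=> /(ceva_radicands_gt0 rho); case: T => [[a b] c] /= [x0 y0 z0].
by rewrite !sqr_sqrtr// ltW.
Qed.

Lemma rel_spread_ceva (R : realType) (rho : R) (T : R * R * R) :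
  oriented_triangle T -> rel_spread (ceva rho T) = rel_spread T.
Proof.
move=> oT; apply: (@rel_spread_scale _ (rho ^+ 2 - rho + 1)).
- by rewrite gt_eqF// ceva_factor_gt0.
- by rewrite squares_ceva// coord_sum_ceva_lin.
- by rewrite squares_ceva// spread_ceva_lin.
Qed.

Lemma positive_ceva_ext (R : realType) (xi : option R) (T : R * R * R) :
  oriented_triangle T -> positive_sides (ceva_ext xi T).
Proof.
case: xi => [rho|] oT; first exact: positive_ceva.
by case: T oT => [[a b] c] [].
Qed.

Lemma rel_spread_ceva_ext (R : realType) (xi : option R) (T : R * R * R) :
  oriented_triangle T -> rel_spread (ceva_ext xi T) = rel_spread T.
Proof.
case: xi => [rho|] oT; first exact: rel_spread_ceva.
case: T {oT} => [[a b] c]; apply: (@rel_spread_scale _ 1);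
  rewrite ?oner_neq0//=; ring.
Qed.

Lemma rel_skew_ceva_infty (R : realType) (T : R * R * R) :
  rel_skew (ceva_ext None T) = rel_skew T.
Proof.
case: T => [[a b] c]; apply: (@rel_skew_scale _ 1); rewrite ?oner_neq0//=; ring.
Qed.

Lemma rel_skew_isosceles (R : realType) (d : R) (T : R * R * R) :
    positive_sides T -> spread (squares T) = d ^+ 2 ->
    skewness (squares T) = 2 * d ^+ 3 ->
  rel_skew T = 2 * (d / coord_sum (squares T)) ^+ 3 /\
  Num.sqrt (rel_spread T) = `|d / coord_sum (squares T)|.
Proof.
move=> pT sE kE; rewrite /rel_skew /rel_spread sE kE -expr_div_n sqrtr_sqr.
by rewrite -mulrA -expr_div_n.
Qed.

(** For a base [t] and legs [s], the spread of the squares is [d^2] and their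
    skewness [2 d^3] with [d = t^2 - s^2], which is positive exactly for wide
    triangles; so these reach the upper bound of [rel_skew_bound], and narrow
    ones the lower bound. *)
Lemma rel_skew_wide (R : realType) (T : R * R * R) :
    positive_sides T -> wide T ->
  rel_skew T = 2 * Num.sqrt (rel_spread T) ^+ 3.
Proof.
move=> pT; have t0 := coord_sum_squares_gt0 pT; rewrite -wide_squares// => w.
suff [d d0 [sE kE]] : exists2 d : R, 0 <= d &
    spread (squares T) = d ^+ 2 /\ skewness (squares T) = 2 * d ^+ 3.
  have [-> ->] := rel_skew_isosceles pT sE kE.
  by rewrite ger0_norm// divr_ge0// ltW.
case: T w {pT t0} => [[a b] c] /=.
by case=> [] [-> lt]; [exists (a ^+ 2 - c ^+ 2)|exists (b ^+ 2 - a ^+ 2)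
                      |exists (c ^+ 2 - b ^+ 2)]; rewrite ?subr_ge0 ?ltW//;
  split; ring.
Qed.

Lemma rel_skew_narrow (R : realType) (T : R * R * R) :
    positive_sides T -> narrow T ->
  rel_skew T = - (2 * Num.sqrt (rel_spread T) ^+ 3).
Proof.
move=> pT; have t0 := coord_sum_squares_gt0 pT; rewrite -narrow_squares// => w.
suff [d d0 [sE kE]] : exists2 d : R, d <= 0 &
    spread (squares T) = d ^+ 2 /\ skewness (squares T) = 2 * d ^+ 3.
  have [-> ->] := rel_skew_isosceles pT sE kE.
  rewrite ler0_norm; first by ring.
  by rewrite ler_pdivrMr// mul0r.
case: T w {pT t0} => [[a b] c] /=.
by case=> [] [-> lt]; [exists (a ^+ 2 - c ^+ 2)|exists (b ^+ 2 - a ^+ 2)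
                      |exists (c ^+ 2 - b ^+ 2)]; rewrite ?subr_le0 ?ltW//;
  split; ring.
Qed.

(** * Wide and narrow triangles among the images *)

Lemma continuous_quadratic (R : realType) (f : R -> R) (x y z : R) :
  (forall r, f r = x + y * r + z * r ^+ 2) -> continuous f.
Proof.
move=> fE; have -> : f = horner (x%:P + y%:P * 'X + z%:P * 'X^2).
  by apply: funext => r; rewrite fE !hornerE.
exact: continuous_horner.
Qed.

Lemma continuous_ceva_lin (R : realType) (p : R * R * R) :
  [/\ continuous (fun rho => (ceva_lin rho p).1.1),
      continuous (fun rho => (ceva_lin rho p).1.2) &
      continuous (fun rho => (ceva_lin rho p).2)].
Proof.
case: p => [[x y] z]; split.
- by apply: (@continuous_quadratic _ _ y (x - y - z) z) => r /=; ring.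
- by apply: (@continuous_quadratic _ _ x (z - x - y) y) => r /=; ring.
- by apply: (@continuous_quadratic _ _ z (y - z - x) x) => r /=; ring.
Qed.

Lemma exists_eq_min (R : realType) (f g h : R -> R) :
    continuous f -> continuous g -> continuous h ->
    f 0 <= g 0 -> f 0 <= h 0 -> g 1 <= f 1 \/ h 1 <= f 1 ->
  exists2 rho, 0 <= rho <= 1 & f rho = Num.min (g rho) (h rho).
Proof.
move=> cf cg ch fg0 fh0 h1.
have cF : continuous (fun r => f r - Num.min (g r) (h r)).
  move=> r; apply: (@cvgB _ _ _ _ _ f); first exact: cf.
  by apply: continuous_min; [exact: cg|exact: ch].
have := @IVT R (fun r => f r - Num.min (g r) (h r)) 0 1 0 ler01
  (continuous_subspaceT cF).
case=> [|r]; last first.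
  by rewrite in_itv => r01 /eqP; rewrite subr_eq0 => /eqP; exists r.
rewrite ge_min le_max !subr_le0 !subr_ge0 !le_min !ge_min fg0 fh0 /=.
by case: h1 => ->; rewrite ?orbT.
Qed.

Lemma ceva_lin0 (R : realType) (x y z : R) : ceva_lin 0 (x, y, z) = (y, x, z).
Proof. by rewrite /=; congr (_, _, _); ring. Qed.

Lemma ceva_lin1 (R : realType) (x y z : R) : ceva_lin 1 (x, y, z) = (x, z, y).
Proof. by rewrite /=; congr (_, _, _); ring. Qed.

(** When [rho] goes from 0 to 1 the triple undergoes a cyclic shift, so the
    position of its least entry has to change; when it changes, the two least
    entries are equal, and the triple is wide since it is never equilateral.
    A wide triple at [rho = 1] is also found, shifted, at [rho = 0]. *)
Lemma exists_wide_ceva_lin (R : realType) (p : R * R * R) :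
  ~ equilateral p -> exists2 rho, 0 <= rho < 1 & wide (ceva_lin rho p).
Proof.
move=> np.
have ns rho : ~ equilateral (ceva_lin rho p).
  move=> e; apply: np; apply: spread_eq0.
  have : spread (ceva_lin rho p) = 0.
    by case: (ceva_lin rho p) e => [[u v] w] [-> ->] /=; ring.
  rewrite spread_ceva_lin => /eqP; rewrite mulf_eq0 expf_eq0 /=.
  by rewrite (gt_eqF (ceva_factor_gt0 rho)) => /eqP.
suff [rho /andP[r0 r1] w] : exists2 rho, 0 <= rho <= 1 & wide (ceva_lin rho p).
  move: r1; rewrite le_eqVlt => /predU1P[rE|r1]; last first.
    by exists rho => //; rewrite r0.
  (* the triple at 0 is a cyclic shift of the triple at 1 *)
  exists 0; rewrite ?lexx ?ltr01//; move: w; rewrite rE.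
  case: p {np ns} => [[x y] z]; rewrite ceva_lin0 ceva_lin1.
  by case=> h; [constructor 2|constructor 3|constructor 1].
have [cX cY cZ] := continuous_ceva_lin p.
(* if an entry is the minimum of the other two, the third one is a strict
   maximum *)
have wide_min u v w : ~ equilateral (u, v, w) ->
    [\/ u = Num.min v w, v = Num.min w u | w = Num.min u v] -> wide (u, v, w).
  move=> ne; case=> e; rewrite /wide.
  - case: (ltrgtP v w) e => h e; [by constructor 3; rewrite e
      |by constructor 2; rewrite e|by case: ne; rewrite /= e h].
  - case: (ltrgtP w u) e => h e; [by constructor 1; rewrite e
      |by constructor 3; rewrite e|by case: ne; rewrite /= e h].
  - case: (ltrgtP u v) e => h e; [by constructor 2; rewrite e
      |by constructor 1; rewrite e|by case: ne; rewrite /= e h].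
case: p np ns cX cY cZ => [[x y] z] np ns cX cY cZ.
have [[xy xz]|[[yz yx]|[zx zy]]] :
    (x <= y /\ x <= z) \/ (y <= z /\ y <= x) \/ (z <= x /\ z <= y).
  by case: (leP x y); case: (leP y z); case: (leP z x) => *;
    (try by left; split; lra); (try by right; left; split; lra);
    right; right; split; lra.
- have [|||rho r01 e] := exists_eq_min cY cZ cX; cbv beta;
    rewrite ?ceva_lin0 ?ceva_lin1 //=.
  + by right.
  + by exists rho => //; apply: wide_min; [exact: ns|constructor 2].
- have [|||rho r01 e] := exists_eq_min cX cY cZ; cbv beta;
    rewrite ?ceva_lin0 ?ceva_lin1 //=.
  + by right.
  + by exists rho => //; apply: wide_min; [exact: ns|constructor 1].
- have [|||rho r01 e] := exists_eq_min cZ cX cY; cbv beta;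
    rewrite ?ceva_lin0 ?ceva_lin1 //=.
  + by right.
  + by exists rho => //; apply: wide_min; [exact: ns|constructor 3].
Qed.

(** Negating the triple exchanges wide and narrow. *)
Lemma exists_narrow_ceva_lin (R : realType) (p : R * R * R) :
  ~ equilateral p -> exists2 rho, 0 <= rho < 1 & narrow (ceva_lin rho p).
Proof.
case: p => [[x y] z] np.
have [|rho r01 w] := @exists_wide_ceva_lin R (- x, - y, - z).
  by move=> [/oppr_inj e1 /oppr_inj e2]; apply: np.
exists rho => //; move: w => /=; rewrite !mulrN -!opprD.
by case=> [] [/oppr_inj e lt]; rewrite ltrN2 in lt;
  [constructor 1|constructor 2|constructor 3].
Qed.

Lemma equilateral_squares (R : realType) (T : R * R * R) :
  positive_sides T -> equilateral (squares T) -> equilateral T.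
Proof.
by case: T => [[a b] c] [a0 b0 c0] /=; rewrite !eqr_sqr_gt0.
Qed.

Lemma ceva_muP (R : realType) (T : R * R * R) :
    oriented_triangle T -> ~ equilateral T -> wide (ceva (ceva_mu T) T).
Proof.
move=> oT nT; have pT := oriented_triangle_positive oT.
have [|rho r01 w] := @exists_wide_ceva_lin R (squares T).
  by move/(equilateral_squares pT).
rewrite /ceva_mu.
case: (@xgetPex _ 0
  [set rho : R | (rho \in `[0, 1[) /\ wide (ceva rho T)]%classic) => //.
exists rho; split; first by rewrite inE /= in_itv.
by rewrite /= -wide_squares ?squares_ceva//; apply: positive_ceva.
Qed.

Lemma ceva_nuP (R : realType) (T : R * R * R) :
    oriented_triangle T -> ~ equilateral T -> narrow (ceva (ceva_nu T) T).
Proof.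
move=> oT nT; have pT := oriented_triangle_positive oT.
have [|rho r01 w] := @exists_narrow_ceva_lin R (squares T).
  by move/(equilateral_squares pT).
rewrite /ceva_nu.
case: (@xgetPex _ 0
  [set rho : R | (rho \in `[0, 1[) /\ narrow (ceva rho T)]%classic) => //.
exists rho; split; first by rewrite inE /= in_itv.
by rewrite /= -narrow_squares ?squares_ceva//; apply: positive_ceva.
Qed.

(** [ceva_MM] does not tell which of its two ends is [ceva_mu]. *)
Lemma IVT_unordered (R : realType) (f : R -> R) (a b : R) :
    continuous f -> f b <= 0 <= f a ->
  exists2 c, c \in `[Num.min a b, Num.max a b] & f c = 0.
Proof.
move=> cf /andP[fb fa].
apply: IVT; [by case: (leP a b) => // /ltW|exact: continuous_subspaceT|].
by case: (leP a b) => _; rewrite ge_min le_max fb fa /= ?orbT.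
Qed.

Lemma continuous_skewness_ceva_lin (R : realType) (k : R) (p : R * R * R) :
  continuous (fun rho =>
    skewness (ceva_lin rho p) - k * coord_sum (ceva_lin rho p) ^+ 3).
Proof.
case: p => [[x y] z].
pose X := y%:P + (x - y - z)%:P * 'X + z%:P * 'X^2.
pose Y := x%:P + (z - x - y)%:P * 'X + y%:P * 'X^2.
pose Z := z%:P + (y - z - x)%:P * 'X + x%:P * 'X^2.
have -> : (fun rho => skewness (ceva_lin rho (x, y, z))
      - k * coord_sum (ceva_lin rho (x, y, z)) ^+ 3)
    = horner ((2%:P * X - Y - Z) * (2%:P * Y - Z - X) * (2%:P * Z - X - Y)
              - k%:P * (X + Y + Z) ^+ 3).
  apply: funext => r; rewrite /X /Y /Z !(hornerE, horner_exp) /=.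
  by ring.
exact: continuous_horner.
Qed.

(** Between [ceva_mu T] and [ceva_nu T] the relative skewness of [ceva rho T]
    runs continuously from its largest to its smallest possible value at the
    given relative spread, hence takes the value of [V] in between. *)
Lemma exists_ceva_similar (R : realType) (T V : R * R * R) :
    oriented_triangle T -> ~ equilateral T -> oriented_triangle V ->
    rel_spread V = rel_spread T ->
  exists rho : R, rho \in ceva_MM T /\ similar_triangles V (ceva rho T).
Proof.
move=> oT nT oV sVT.
have pC rho := positive_ceva rho oT.
have pV := oriented_triangle_positive oV.
(* [rel_skew (ceva rho T) - rel_skew V] cleared of its denominator *)
pose phi rho := skewness (ceva_lin rho (squares T))
  - rel_skew V * coord_sum (ceva_lin rho (squares T)) ^+ 3.
have phiE rho : phi rho =
    (rel_skew (ceva rho T) - rel_skew V)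
      * coord_sum (squares (ceva rho T)) ^+ 3.
  rewrite mulrBl /rel_skew divfK; last first.
    by rewrite expf_neq0// gt_eqF// coord_sum_squares_gt0.
  by rewrite squares_ceva.
have cphi : continuous phi.
  exact: continuous_skewness_ceva_lin.
have /ler_normlP[lo hi] := rel_skew_bound pV.
have := @IVT_unordered R phi (ceva_mu T) (ceva_nu T) cphi.
case=> [|rho rin]; last first.
  rewrite phiE => /eqP; rewrite mulf_eq0 expf_eq0 /=.
  rewrite (gt_eqF (coord_sum_squares_gt0 (pC _))) orbF subr_eq0 => /eqP kE.
  exists rho; split => //; apply: similar_of_invariants => //.
  by rewrite rel_spread_ceva.
rewrite !phiE (rel_skew_wide (pC _) (ceva_muP oT nT)).
rewrite (rel_skew_narrow (pC _) (ceva_nuP oT nT)) !rel_spread_ceva// -sVT.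
rewrite pmulr_lle0 ?pmulr_lge0 ?exprn_gt0 ?coord_sum_squares_gt0//.
by apply/andP; split; lra.
Qed.

(** * The cone angle *)

Lemma dot_ge0 (R : realType) (n : nat) (u : 'rV[R]_n) : 0 <= dot u u.
Proof. by apply: sumr_ge0 => i _; rewrite -expr2 sqr_ge0. Qed.

Lemma cone_angleE (R : realType) (T : R * R * R) :
    positive_sides T ->
  cone_angle T = acos (Num.sqrt (1 + 2 * rel_spread T))^-1.
Proof.
move=> pT; have t0 := coord_sum_squares_gt0 pT.
have <- : coord_sum (squares T) / Num.sqrt (coord_sum (squares T) ^+ 2
    + 2 * spread (squares T)) = (Num.sqrt (1 + 2 * rel_spread T))^-1.
  have -> : coord_sum (squares T) ^+ 2 + 2 * spread (squares T)
      = coord_sum (squares T) ^+ 2 * (1 + 2 * rel_spread T).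
    by rewrite /rel_spread; field; rewrite gt_eqF.
  rewrite sqrtrM ?sqr_ge0// sqrtr_sqr ger0_norm ?ltW//.
  rewrite invfM mulrA divff ?mul1r//.
  by rewrite gt_eqF.
case: T {t0} pT => [[a b] c] pT; rewrite /cone_angle /vec_angle /enorm.
have dotE : dot (\row_(i < 3) [:: a ^+ 2; b ^+ 2; c ^+ 2]`_i) (const_mx 1)
    = coord_sum (squares (a, b, c)).
  by rewrite /dot !big_ord_recl big_ord0 !mxE /=; ring.
rewrite dotE -sqrtrM ?dot_ge0//.
congr (acos (_ / Num.sqrt _)).
by rewrite /dot !big_ord_recl !big_ord0 !mxE /=; ring.
Qed.

Lemma cone_angle_rel_spread (R : realType) (T V : R * R * R) :
    positive_sides T -> positive_sides V ->
  cone_angle T = cone_angle V <-> rel_spread T = rel_spread V.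
Proof.
move=> pT pV; rewrite !cone_angleE//; split=> [e|->//].
have pos (W : R * R * R) : 1 <= 1 + 2 * rel_spread W.
  by rewrite lerDl mulr_ge0// rel_spread_ge0.
have dom (W : R * R * R) : (Num.sqrt (1 + 2 * rel_spread W))^-1 \in `[-1, 1].
  rewrite in_itv /=; apply/andP; split.
    by rewrite (@le_trans _ _ 0)// invr_ge0 sqrtr_ge0.
  have /ler_wsqrtr : 1 <= 1 + 2 * rel_spread W by [].
  by rewrite sqrtr1 => s1; rewrite invf_le1// (lt_le_trans ltr01).
have /invr_inj : (Num.sqrt (1 + 2 * rel_spread T))^-1
    = (Num.sqrt (1 + 2 * rel_spread V))^-1.
  by rewrite -(acosK (dom T)) e acosK.
move/(congr1 (fun x => x ^+ 2)); rewrite !sqr_sqrtr ?(le_trans ler01)//.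
by move/addrI/mulfI => ->//; rewrite pnatr_eq0.
Qed.

(** * The Brocard angle *)

Definition cross (R : realType) (u v : 'rV[R]_2) : R :=
  u 0 0 * v 0 1 - u 0 1 * v 0 0.

(** The arc cotangent with values in the open interval from 0 to pi, written by
    means of [acos] as [vec_angle] is. *)
Definition acot (R : realType) (k : R) : R := acos (k / Num.sqrt (1 + k ^+ 2)).

(** The cosine [g] of the angle gives back its cotangent as [g / sqrt (1 - g^2)]. *)
Lemma acot_inj (R : realType) : injective (@acot R).
Proof.
pose f (w : R) := cos w / Num.sqrt (1 - cos w ^+ 2).
apply: (can_inj (g := f)) => k; rewrite /f /acot.
have s1 : 0 < 1 + k ^+ 2 by rewrite ltr_pwDl// sqr_ge0.
set s := Num.sqrt _; have s0 : 0 < s by rewrite sqrtr_gt0.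
have sE : s ^+ 2 = 1 + k ^+ 2 by rewrite sqr_sqrtr// ltW.
have ks : `|k| <= s.
  by rewrite -sqrtr_sqr ler_wsqrtr// lerDr.
rewrite acosK; last first.
  rewrite in_itv /= ler_pdivlMr// ler_pdivrMr// mulN1r mul1r.
  by rewrite -ler_norml.
have -> : 1 - (k / s) ^+ 2 = s^-1 ^+ 2.
  by rewrite expr_div_n exprVn sE; field; rewrite gt_eqF.
by rewrite sqrtr_sqr ger0_norm ?invr_ge0 ?ltW// invrK divfK// gt_eqF.
Qed.

Lemma dot2E (R : realType) (u v : 'rV[R]_2) :
  dot u v = u 0 0 * v 0 0 + u 0 1 * v 0 1.
Proof.
rewrite /dot !big_ord_recl big_ord0 addr0.
by congr (_ + u _ _ * v _ _); apply: val_inj.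
Qed.

(** By Lagrange's identity [dot u u * dot v v = dot u v ^ 2 + cross v u ^ 2], the
    quotient of [dot] by [cross] is the cotangent of the angle. *)
Lemma vec_angle_acot (R : realType) (k : R) (u v : 'rV[R]_2) :
  0 < cross v u -> dot u v = k * cross v u -> vec_angle u v = acot k.
Proof.
move=> c0 dE; have lagrange : dot u u * dot v v = cross v u ^+ 2 * (1 + k ^+ 2).
  have -> : cross v u ^+ 2 * (1 + k ^+ 2) = cross v u ^+ 2 + dot u v ^+ 2.
    by rewrite dE; ring.
  by rewrite !dot2E /cross; ring.
rewrite /vec_angle /enorm -sqrtrM ?dot_ge0// lagrange.
rewrite sqrtrM ?sqr_ge0// sqrtr_sqr.
rewrite ger0_norm ?ltW// dE /acot; congr acos.
by rewrite invfM mulrA mulfK// gt_eqF.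
Qed.

(** By Heron's formula the difference is a positive multiple of the squared
    area. *)
Lemma rel_spread_lt (R : realType) (T : R * R * R) :
  oriented_triangle T -> 0 < 1 - 4 * rel_spread T.
Proof.
move=> oT; have pT := oriented_triangle_positive oT.
have t0 := coord_sum_squares_gt0 pT.
suff h : 0 < coord_sum (squares T) ^+ 2 - 4 * spread (squares T).
  have -> : 1 - 4 * rel_spread T
      = (coord_sum (squares T) ^+ 2 - 4 * spread (squares T))
        / coord_sum (squares T) ^+ 2.
    by rewrite /rel_spread; field; rewrite gt_eqF.
  by rewrite divr_gt0// exprn_gt0.
case: T {pT t0} oT => [[a b] c] /= [a0 b0 c0].
rewrite ltr_norml => /andP[h1 h2] h3.
set d := (X in 0 < X).
have -> : d = 3 * ((a + b + c) * (b + c - a) * (c + a - b) * (a + b - c)).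
  by rewrite /d; ring.
by rewrite !mulr_gt0//; lra.
Qed.

(** The classical [(a^2 + b^2 + c^2) / (4 area)], the area being expressed by
    Heron's formula. *)
Definition brocard_cot (R : realType) (T : R * R * R) : R :=
  (Num.sqrt ((1 - 4 * rel_spread T) / 3))^-1.

Lemma brocard_cotE (R : realType) (T : R * R * R) (d : R) :
    positive_sides T -> 0 < d ->
    12 * d ^+ 2 = coord_sum (squares T) ^+ 2 - 4 * spread (squares T) ->
  brocard_cot T = coord_sum (squares T) / (2 * d).
Proof.
move=> pT d0 dE; have t0 := coord_sum_squares_gt0 pT.
rewrite /brocard_cot.
have -> : (1 - 4 * rel_spread T) / 3 = (2 * d / coord_sum (squares T)) ^+ 2.
  have -> : rel_spread T = (coord_sum (squares T) ^+ 2 - 12 * d ^+ 2) / 4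
      / coord_sum (squares T) ^+ 2.
    by rewrite dE /rel_spread; congr (_ / _); field.
  by field; rewrite gt_eqF.
by rewrite sqrtr_sqr ger0_norm ?invf_div// divr_ge0// ?mulr_ge0// ltW.
Qed.

Lemma vertices_squares (R : realType) (T : R * R * R) (A B C : 'rV[R]_2) :
    vertices T A B C ->
  squares T = (dot (C - B) (C - B), dot (A - C) (A - C), dot (B - A) (B - A)).
Proof.
by case: T => [[a b] c] [_ <- <- <-] /=; rewrite !sqr_sqrtr ?dot_ge0.
Qed.

Lemma vertices_cot (R : realType) (T : R * R * R) (A B C : 'rV[R]_2) :
    positive_sides T -> vertices T A B C ->
  brocard_cot T = coord_sum (squares T) / (2 * cross (B - A) (C - A)).
Proof.
move=> pT vT; apply: brocard_cotE => //.
  by case: T pT vT => [[a b] c] _ [].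
by rewrite (vertices_squares vT) /coord_sum /spread !dot2E /cross !mxE; ring.
Qed.

(** The three equal angles have a common cotangent [k], so that each [dot] is [k]
    times the [cross] of the same vectors. Summed over the three angles, the
    latter give twice the area of [ABC] and the former half the sum of the
    squared sides, whatever the point [P] is. *)
Lemma brocard_point_angle (R : realType) (T : R * R * R) (A B C P : 'rV[R]_2) :
    positive_sides T -> vertices T A B C -> brocard_point A B C P ->
  pt_angle P A B = acot (brocard_cot T).
Proof.
move=> pT vT [[cAB cBC cCA] []]; rewrite /pt_angle.
have cot u v : 0 < cross v u -> dot u v = dot u v / cross v u * cross v u :> R.
  by move=> c0; rewrite divfK// gt_eqF.
rewrite (vec_angle_acot cAB (cot _ _ cAB)) (vec_angle_acot cBC (cot _ _ cBC)).
rewrite (vec_angle_acot cCA (cot _ _ cCA)) => /acot_inj kB /acot_inj kC.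
set k := dot _ _ / _ in kB *; congr acot.
have dA := cot _ _ cAB; have dB := cot _ _ cBC; have dC := cot _ _ cCA.
rewrite -kC -kB in dC; rewrite -kB in dB; rewrite -/k in dA.
have D0 : 0 < cross (B - A) (C - A) by case: T pT vT => [[a b] c] _ [].
rewrite (vertices_cot pT vT).
apply: (canRL (mulfK _)); first by rewrite gt_eqF// mulr_gt0.
transitivity (2 * (k * cross (B - A) (P - A) + k * cross (C - B) (P - B)
  + k * cross (A - C) (P - C))).
  by rewrite /cross !mxE; ring.
rewrite -dA -dB -dC (vertices_squares vT) /coord_sum !dot2E !mxE; ring.
Qed.

(** In barycentric coordinates, the point [c^2 a^2 : a^2 b^2 : b^2 c^2] is a
    Brocard point; it is interior since these coordinates are positive. The
    triangle is placed with [A] at the origin and [B] on the positive horizontal axis. *)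
Lemma exists_brocard_point (R : realType) (T : R * R * R) :
    oriented_triangle T ->
  exists A B C P : 'rV[R]_2, vertices T A B C /\ brocard_point A B C P.
Proof.
case: T => [[a b] c] [a0 b0 c0]; rewrite ltr_norml => /andP[h1 h2] h3.
(* [u] and [v] will be the coordinates of [C]: its projection on the line [AB],
   by the law of cosines, and its height. *)
pose u := (b ^+ 2 + c ^+ 2 - a ^+ 2) / (2 * c).
have cu : 2 * (c * u) = b ^+ 2 + c ^+ 2 - a ^+ 2.
  by rewrite /u; field; rewrite gt_eqF.
have v2 : 0 < b ^+ 2 - u ^+ 2.
  have -> : b ^+ 2 - u ^+ 2
      = (a + b + c) * (b + c - a) * (c + a - b) * (a + b - c) / (2 * c) ^+ 2.
    by rewrite /u; field; rewrite gt_eqF.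
  by rewrite divr_gt0 ?exprn_gt0// ?mulr_gt0//; lra.
pose v := Num.sqrt (b ^+ 2 - u ^+ 2).
have v0 : 0 < v by rewrite sqrtr_gt0.
have bE : b ^+ 2 = u ^+ 2 + v ^+ 2 by rewrite sqr_sqrtr ?ltW//; ring.
have aE : a ^+ 2 = (c - u) ^+ 2 + v ^+ 2 by move: cu; rewrite bE; lra.
clearbody u v.
pose al := a ^+ 2 * c ^+ 2; pose be := a ^+ 2 * b ^+ 2.
pose ga := b ^+ 2 * c ^+ 2; pose s := al + be + ga.
pose pt (x y : R) : 'rV[R]_2 := \row_(i < 2) [:: x; y]`_i.
pose A := pt 0 0; pose B := pt c 0; pose C := pt u v.
pose P := pt ((be * c + ga * u) / s) (ga * v / s).
have [al0 be0 ga0] : [/\ 0 < al, 0 < be & 0 < ga].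
  by split; rewrite mulr_gt0// exprn_gt0.
have s0 : 0 < s by rewrite !addr_gt0.
have s0' : s != 0 by rewrite gt_eqF.
have ptE x y : (pt x y 0 0 = x) * (pt x y 0 1 = y) by split; rewrite mxE.
have coordE (p q : 'rV[R]_2) i : (p - q) 0 i = p 0 i - q 0 i by rewrite !mxE.
have normE w r : 0 < r -> dot w w = r ^+ 2 -> enorm w = r :> R.
  by move=> r0; rewrite /enorm => ->; rewrite sqrtr_sqr ger0_norm// ltW.
have crossA : cross (B - A) (P - A) = c * v * ga / s.
  by rewrite /cross !coordE !ptE; field.
have crossB : cross (C - B) (P - B) = c * v * al / s.
  by rewrite /cross !coordE !ptE /s; field.
have crossC : cross (A - C) (P - C) = c * v * be / s.
  by rewrite /cross !coordE !ptE /s; field.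
have pos w : 0 < w -> 0 < c * v * w / s.
  by move=> w0; rewrite !mulr_gt0 ?invr_gt0.
have ccwP : [/\ ccw A B P, ccw B C P & ccw C A P].
  split.
  - by have := pos _ ga0; rewrite -crossA.
  - by have := pos _ al0; rewrite -crossB.
  - by have := pos _ be0; rewrite -crossC.
pose k := (a ^+ 2 + b ^+ 2 + c ^+ 2) / (2 * (c * v)).
have cv0 : c * v != 0 by rewrite gt_eqF// mulr_gt0.
exists A, B, C, P; split.
  split.
  - by rewrite /ccw !coordE !ptE !subr0 mul0r subr0 mulr_gt0.
  - by apply: normE => //; rewrite dot2E !coordE !ptE aE; ring.
  - by apply: normE => //; rewrite dot2E !coordE !ptE bE; ring.
  - by apply: normE => //; rewrite dot2E !coordE !ptE; ring.
split=> //; rewrite /pt_angle.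
have kE w : k * (c * v * w / s) = (a ^+ 2 + b ^+ 2 + c ^+ 2) * w / (2 * s).
  by rewrite /k; field; rewrite s0' !gt_eqF.
have dotA : dot (P - A) (B - A) = k * (c * v * ga / s).
  rewrite kE dot2E !coordE !ptE; move: s0'; rewrite /s /al /be /ga aE bE => ?.
  by field.
have dotB : dot (P - B) (C - B) = k * (c * v * al / s).
  rewrite kE dot2E !coordE !ptE; move: s0'; rewrite /s /al /be /ga aE bE => ?.
  by field.
have dotC : dot (P - C) (A - C) = k * (c * v * be / s).
  rewrite kE dot2E !coordE !ptE; move: s0'; rewrite /s /al /be /ga aE bE => ?.
  by field.
by rewrite (@vec_angle_acot _ k (P - A)) ?(@vec_angle_acot _ k (P - B))
  ?(@vec_angle_acot _ k (P - C)) ?crossA ?crossB ?crossC ?pos.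
Qed.

Lemma brocard_angleE (R : realType) (T : R * R * R) :
  oriented_triangle T -> brocard_angle T = acot (brocard_cot T).
Proof.
move=> oT; have pT := oriented_triangle_positive oT.
rewrite /brocard_angle; case: xgetP => [w -> [A [B [C [P [vT bP ->]]]]]|no].
  exact: brocard_point_angle bP.
have [A [B [C [P [vT bP]]]]] := exists_brocard_point oT.
by case: (no (pt_angle P A B)); exists A, B, C, P.
Qed.

Lemma brocard_angle_rel_spread (R : realType) (T V : R * R * R) :
    oriented_triangle T -> oriented_triangle V ->
  brocard_angle T = brocard_angle V <-> rel_spread T = rel_spread V.
Proof.
move=> oT oV; rewrite !brocard_angleE//; split=> [/acot_inj/invr_inj|e].
  have pos W : oriented_triangle W -> 0 <= (1 - 4 * rel_spread W) / 3.
    by move=> /rel_spread_lt/ltW h; rewrite divr_ge0.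
  move/(congr1 (fun x => x ^+ 2)); rewrite !sqr_sqrtr ?pos// => e; lra.
by rewrite /brocard_cot e.
Qed.

(** * The equivalence *)

Theorem theorem11p1 (R : realType) (T V : R * R * R)
    (hT : oriented_triangle T) (hV : oriented_triangle V)
    (nT : ~ equilateral T) (nV : ~ equilateral V) :
  [<-> (exists xi zeta : option R, similar_triangles (ceva_ext zeta V) (ceva_ext xi T));
       (exists rho : R, rho \in ceva_MM T /\ similar_triangles V (ceva rho T));
       (exists tau : R, tau \in ceva_MM V /\ similar_triangles T (ceva tau V));
       similar_triangles (ceva (ceva_mu T) T) (ceva (ceva_mu V) V);
       similar_triangles (ceva (ceva_nu T) T) (ceva (ceva_nu V) V);
       cone_angle T = cone_angle V;
       brocard_angle T = brocard_angle V].
Proof.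
have pT := oriented_triangle_positive hT.
have pV := oriented_triangle_positive hV.
have pCT rho := positive_ceva rho hT; have pCV rho := positive_ceva rho hV.
pose same := rel_spread T = rel_spread V.
have a_same : (exists xi zeta : option R,
    similar_triangles (ceva_ext zeta V) (ceva_ext xi T)) -> same.
  move=> [xi [zeta /similar_invariants]].
  by case; rewrite ?rel_spread_ceva_ext//; apply: positive_ceva_ext.
have b_same : (exists rho : R,
    rho \in ceva_MM T /\ similar_triangles V (ceva rho T)) -> same.
  by move=> [rho [_ /similar_invariants[]//]]; rewrite rel_spread_ceva.
have c_same : (exists tau : R,
    tau \in ceva_MM V /\ similar_triangles T (ceva tau V)) -> same.
  by move=> [tau [_ /similar_invariants[]//]]; rewrite rel_spread_ceva.
have ceva_same rho tau :
    similar_triangles (ceva rho T) (ceva tau V) -> same.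
  by case/similar_invariants=> //; rewrite !rel_spread_ceva.
have cone := cone_angle_rel_spread pT pV.
have brocard := brocard_angle_rel_spread hT hV.
have same_b : same -> exists rho : R,
    rho \in ceva_MM T /\ similar_triangles V (ceva rho T).
  by move=> e; apply: exists_ceva_similar.
have same_c : same -> exists tau : R,
    tau \in ceva_MM V /\ similar_triangles T (ceva tau V).
  by move=> e; apply: exists_ceva_similar.
have same_d : same ->
    similar_triangles (ceva (ceva_mu T) T) (ceva (ceva_mu V) V).
  move=> e; apply: similar_of_invariants => //; rewrite ?rel_skew_wide//;
    try exact: ceva_muP; by rewrite !rel_spread_ceva// e.
have same_e : same ->
    similar_triangles (ceva (ceva_nu T) T) (ceva (ceva_nu V) V).
  move=> e; apply: similar_of_invariants => //; rewrite ?rel_skew_narrow//;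
    try exact: ceva_nuP; by rewrite !rel_spread_ceva// e.
have same_a : same -> exists xi zeta : option R,
    similar_triangles (ceva_ext zeta V) (ceva_ext xi T).
  move=> /same_b[rho [_ /similar_invariants[//|//|sE kE]]].
  (* the operator of index [oo] only permutes the sides of [V] *)
  exists (Some rho), None; apply: similar_of_invariants.
  - exact: positive_ceva_ext.
  - exact: pCT.
  - by rewrite rel_spread_ceva_ext.
  - by rewrite rel_skew_ceva_infty.
tfae.
- by move=> /a_same.
- by move=> /b_same.
- by move=> /c_same.
- by move=> /ceva_same.
- by move=> /ceva_same/cone.
- by move=> /cone/brocard.
- by move=> /brocard.
Qed.
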